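(* Let $X$ be a locally convex Hausdorff topological vector space, and let $g,h:X\to\overline{\mathbb R}$ be proper generalized polyhedral convex functions given by $$g(x)=\max_{i\in I}\big[\langle u_i^*,x\rangle+\alpha_i\big]\ \ \forall x\in\mathrm{dom}\,g,\qquad h(x)=\max_{j\in J}\big[\langle v_j^*,x\rangle+\beta_j\big]\ \ \forall x\in\mathrm{dom}\,h,$$ where $I=\{1,\dots,m\}$, $J=\{1,\dots,q\}$, $u_i^*,v_j^*\in X^*$, $\alpha_i,\beta_j\in\mathbb R$. Let $C\subset X$ be a nonempty generalized polyhedral convex set given by $$C=\{x\in X\mid A(x)=y,\ \langle x_k^*,x\rangle\le\gamma_k,\ k=1,\dots,p\},$$ where $A:X\to Y$ is a continuous surjective linear mapping into a locally convex Hausdorff topological vector space $Y$, $y\in Y$, $x_k^*\in X^*$, $\gamma_k\in\mathbb R$. Then a point $\bar x\in\mathrm{int}(\mathrm{dom}\,g)\cap\mathrm{int}(\mathrm{dom}\,h)\cap C$ is a local solution of the problem of minimizing $f(x):=g(x)-h(x)$ over $x\in C$ if and only if $$\mathrm{co}\{v_j^*\mid j\in J(\bar x)\}\subset\mathrm{co}\{u_i^*\mid i\in I(\bar x)\}+\mathrm{pos}\{x_k^*\mid k\in K(\bar x)\}+(\ker A)^\perp,$$ where $I(\bar x)=\{i\in I\mid\langle u_i^*,\bar x\rangle+\alpha_i=g(\bar x)\}$, $J(\bar x)=\{j\in J\mid\langle v_j^*,\bar x\rangle+\beta_j=h(\bar x)\}$, and $K(\bar x)=\{k\in\{1,\dots,p\}\mid\langle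 x_k^*,\bar x\rangle=\gamma_k\}$.
   Context: $\overline{\mathbb R}=\mathbb R\cup\{\pm\infty\}$, with the convention $(+\infty)-(+\infty)=+\infty$. $X^*$ is the topological dual of $X$. $\mathrm{dom}\,\varphi=\{x\mid\varphi(x)<+\infty\}$, $\mathrm{epi}\,\varphi=\{(x,\alpha)\in X\times\mathbb R\mid x\in\mathrm{dom}\,\varphi,\ \varphi(x)\le\alpha\}$; $\varphi$ is proper if $\mathrm{dom}\,\varphi\ne\emptyset$ and $\varphi>-\infty$ everywhere. $\mathrm{int}$ denotes interior, $\mathrm{co}$ the convex hull. A subset of a locally convex Hausdorff topological vector space $Z$ is generalized polyhedral convex if it has the form $\{z\in L\mid\langle z_k^*,z\rangle\le\gamma_k,\ k=1,\dots,p\}$ with $L\subset Z$ a closed affine subspace, $z_k^*\in Z^*$, $\gamma_k\in\mathbb R$. A function is generalized polyhedral convex if its epigraph is a generalized polyhedral convex set in $X\times\mathbb R$; every proper generalized polyhedral convex function has a generalized polyhedral convex domain and is a maximum of finitely many continuous affine functions on that domain. $\mathrm{pos}\{x_k^*\mid k\in K(\bar x)\}=\{\sum_{k\in K(\bar x)}\lambda_kx_k^*\mid\lambda_k\ge0\ \forall k\in K(\bar x)\}$ (equal to $\{0\}$ if $K(\bar x)=\emptyset$); $\ker A=\{x\in X\mid Ax=0\}$; $(\ker A)^\perp=\{x^*\in X^*\mid\langle x^*,x\rangle=0\ \forall x\in\ker A\}$. A point $\bar x\in C$ is a local solution if there is a neighborhood $U$ of $\bar x$ with $f(\bar x)\le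 f(x)$ for all $x\in C\cap U$. *)

(* Defs.v *)
From HB Require Import structures.
From mathcomp Require Import all_boot all_order all_algebra.
From mathcomp Require Import all_classical all_reals all_analysis.

Set Implicit Arguments.
Unset Strict Implicit.
Unset Printing Implicit Defensive.

Import Order.TTheory GRing.Theory Num.Theory.
Import numFieldNormedType.Exports.

Local Open Scope classical_set_scope.
Local Open Scope ring_scope.

Section TopologicalDual.
Context {R : realType} (X : tvsType R).

Definition is_dual : {pred X -> R^o} :=
  [pred f : X -> R^o | `[< linear f /\ continuous f >] ].

Lemma is_dual_submod_closed : submod_closed is_dual.
Proof.
split.
  apply/asboolP; split; last exact: cst_continuous.
  by move=> a x y; rewrite /= scaler0 addr0.
move=> a f k /asboolP[lf cf] /asboolP[lk ck]; apply/asboolP; split.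
  move=> b x y; rewrite !fctE /= lf lk.
  by rewrite !scalerDr !scalerA [b * a]mulrC addrACA.
move=> x; apply: (@cvgD R R^o); last exact: ck.
by apply: (@cvgZl_tmp R R^o); exact: cf.
Qed.

HB.instance Definition _ :=
  GRing.isSubmodClosed.Build R (X -> R^o) is_dual is_dual_submod_closed.

Record topdual := TopDual { dual_fun :> X -> R^o ; _ : dual_fun \in is_dual }.

HB.instance Definition _ := [isSub for dual_fun].
HB.instance Definition _ := [Choice of topdual by <:].
HB.instance Definition _ := [SubChoice_isSubLmodule of topdual by <:].

Lemma topdual_linear (f : topdual) : linear f.
Proof. by case: f => f /= /asboolP[]. Qed.

Lemma topdual_continuous (f : topdual) : continuous f.
Proof. by case: f => f /= /asboolP[]. Qed.

Lemma topdualD (f k : topdual) (x : X) : (f + k) x = f x + k x.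
Proof. by []. Qed.

Lemma topdualZ (a : R) (f : topdual) (x : X) : (a *: f) x = a * f x.
Proof. by []. Qed.

End TopologicalDual.

Section Polyhedral.
Context {R : realType}.

Definition affine_subspace (Z : lmodType R) (L : set Z) : Prop :=
  forall (z w : Z) (t : R), L z -> L w -> L ((1 - t) *: z + t *: w).

Definition gen_polyhedral_convex (Z : tvsType R) (D : set Z) : Prop :=
  exists (L : set Z) (p : nat) (zs : 'I_p -> topdual Z) (gamma : 'I_p -> R),
    [/\ closed L, affine_subspace L &
        D = [set z | L z /\ forall k, zs k z <= gamma k]].

Definition edom (X : Type) (phi : X -> \bar R) : set X :=
  [set x | (phi x < +oo)%E].

(* [R^o] rather than [R], so that the product is a [tvsType]. *)
Definition epi (X : tvsType R) (phi : X -> \bar R) : set (X * R^o)%type :=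
  [set xa | edom phi xa.1 /\ (phi xa.1 <= (xa.2 : R)%:E)%E].

Definition proper_fun (X : Type) (phi : X -> \bar R) : Prop :=
  edom phi !=set0 /\ forall x, (-oo < phi x)%E.

Definition gen_polyhedral_convex_fun (X : tvsType R) (phi : X -> \bar R) :
  Prop := gen_polyhedral_convex (epi phi).

(* The subtraction of [ereal_dual_scope] has (+oo) - (+oo) = +oo, whereas the
   one of [ereal_scope] has (+oo) - (+oo) = -oo. *)
Definition dc_fun (X : Type) (g h : X -> \bar R) : X -> \bar R :=
  fun x => (g x - h x)%dE.

Lemma dc_fun_pinfty (X : Type) (g h : X -> \bar R) (x : X) :
  g x = +oo%E -> h x = +oo%E -> dc_fun g h x = +oo%E.
Proof. by rewrite /dc_fun => -> ->. Qed.

Definition local_solution (X : tvsType R) (C : set X) (f : X -> \bar R)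
    (xbar : X) : Prop :=
  C xbar /\
  exists2 U : set X, nbhs xbar U &
    forall x, (C `&` U) x -> (f xbar <= f x)%E.

Definition conv_hull (V : lmodType R) (A : set V) : set V :=
  smallest (@convex_set R V) A.

Definition pos_hull (V : lmodType R) (I : finType) (K : set I) (v : I -> V) :
    set V :=
  [set w | exists2 lam : I -> R, (forall k, K k -> 0 <= lam k) &
             w = \sum_(k | k \in K) lam k *: v k].

Lemma pos_hull0 (V : lmodType R) (I : finType) (v : I -> V) :
  pos_hull set0 v = [set 0].
Proof.
apply/seteqP; split=> [w [lam _ ->]|w ->] /=.
  by apply: big1 => k; rewrite in_set0.
by exists (fun=> 0) => //; rewrite big1// => k; rewrite in_set0.
Qed.

Definition set_sum (V : lmodType R) (A B : set V) : set V :=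
  [set a + b | a in A & b in B].

Definition ker (X Y : lmodType R) (A : {linear X -> Y}) : set X :=
  [set x | A x = 0].

Definition annihilator (X : tvsType R) (M : set X) : set (topdual X) :=
  [set xs | forall x, M x -> xs x = 0].

Definition constraint_set (X Y : tvsType R) (A : {linear X -> Y}) (y : Y)
    (p : nat) (xs : 'I_p -> topdual X) (gamma : 'I_p -> R) : set X :=
  [set x | A x = y /\ forall k, xs k x <= gamma k].

Definition active_constraints (X : tvsType R) (p : nat)
    (xs : 'I_p -> topdual X) (gamma : 'I_p -> R) (xbar : X) : set 'I_p :=
  [set k | xs k xbar = gamma k].

(* For m = 0 the value is -oo. *)
Definition max_affine (X : tvsType R) (m : nat) (u : 'I_m -> topdual X)
    (alpha : 'I_m -> R) (x : X) : \bar R :=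
  \big[maxe/-oo%E]_(i < m) (u i x + alpha i)%:E.

Definition active_pieces (X : tvsType R) (m : nat) (u : 'I_m -> topdual X)
    (alpha : 'I_m -> R) (phi : X -> \bar R) (xbar : X) : set 'I_m :=
  [set i | (u i xbar + alpha i)%:E = phi xbar].

Lemma constraint_set_gpc (X Y : tvsType R) (A : {linear X -> Y}) (y : Y)
    (p : nat) (xs : 'I_p -> topdual X) (gamma : 'I_p -> R) :
  hausdorff_space Y -> continuous A ->
  gen_polyhedral_convex (constraint_set A y xs gamma).
Proof.
move=> hY cA; exists (A @^-1` [set y]), p, xs, gamma; split => //.
  apply: closed_comp => [x _|]; first exact: cA.
  exact/accessible_closed_set1/hausdorff_accessible.
move=> z w t /= Az Aw.
by rewrite linearD !linearZ /= Az Aw -scalerDl subrK scale1r.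
Qed.

End Polyhedral.

(* Main.v *)
Require Import Defs.
From HB Require Import structures.
From mathcomp Require Import all_boot all_order all_algebra lra.
From mathcomp Require Import all_classical all_reals all_analysis.

Set Implicit Arguments.
Unset Strict Implicit.
Unset Printing Implicit Defensive.

Import Order.TTheory GRing.Theory Num.Theory.
Import numFieldNormedType.Exports.

Local Open Scope classical_set_scope.
Local Open Scope ring_scope.

(** Near [xbar] the maxima defining [g] and [h] only involve their active
    pieces, so that with [d := x - xbar]
<<
    g x - g xbar = max_(i active) u i d,   h x - h xbar = max_(j active) v j d
>>
    ([near_max_affine]).  Feasible directions at [xbar] are the [d] in [ker A]
    with [xs k d <= 0] for every active [k], and in such a direction a short
    step is always feasible.  Local optimality therefore says that, for every
    active [j] and every feasible direction [d], some active [i] has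
    [v j d <= u i d].

    Assume local optimality and fix an active [j].  The system
    [u i d - v j d < 0] (all active [i]), [xs k d <= 0] (all active [k]) has no
    solution in [ker A].  The theorem of the alternative [motzkin] gives
    weights [mu] of sum 1 and multipliers [lam] such that
    [v j - \sum mu i *: u i - \sum lam k *: xs k] vanishes on [ker A]; it is
    then an element of the annihilator, being continuous as a combination of
    continuous functionals.  So every active [v j] lies in the right-hand side,
    which is convex and hence contains their convex hull.  [motzkin] follows from
    [farkas], a purely algebraic statement about finitely many functionals on a
    vector space of any dimension.

    Conversely, let [x] in [C] be near [xbar] and let [j] be an active piece
    attaining [h x].  Decompose [v j] according to the inclusion and evaluate at
    [x - xbar]: the convex part is at most [g x - g xbar], the conic part is
    nonpositive, and the annihilator part is zero as [x - xbar] is in [ker A].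
    Hence [h x - h xbar <= g x - g xbar]. *)

(** * Theorems of the alternative on a linear subspace *)

Section Alternatives.
Context {R : realType}.

(** Induction on the number of functionals. If the one of index [i0] cannot be
    dropped from the hypothesis, there is [x] satisfying all the other
    inequalities with [0 < f0 x], which forces [0 < f i0 x]. On the kernel of
    [f i0] the induction hypothesis expresses [f0] by the other functionals;
    projecting onto this kernel along [x] determines the coefficient of [f i0],
    and the signs of the functionals at [x] make it nonnegative. Working
    inside a subspace [M] is what allows this passage to a kernel. *)
Lemma farkas (V : lmodType R) (I : finType) (P : pred I) (M : set V)
    (f : I -> V -> R) (f0 : V -> R) :
  (forall a x y, M x -> M y -> M (a *: x + y)) ->
  (forall i, scalar (f i)) -> scalar f0 ->
  (forall d, M d -> (forall i, P i -> f i d <= 0) -> f0 d <= 0) ->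
  exists2 lam : I -> R, forall i, 0 <= lam i &
    forall d, M d -> f0 d = \sum_(i | P i) lam i * f i d.
Proof.
move=> + f_lin f0_lin; move: {2}#|P| (erefl #|P|) => n.
elim: n P M => [|n IHn] P M cardP M_lin imp.
  have P0 : P =1 xpred0 by move=> i; apply: (card0_eq cardP).
  exists (fun=> 0) => // d Md; rewrite big_pred0//.
  apply/eqP; rewrite eq_le imp//=; last by move=> i; rewrite P0.
  (* [(-2) *: d + d] is [- d], written so that [M_lin] applies *)
  have : f0 ((-2) *: d + d) <= 0.
    by apply: imp; [exact: M_lin|move=> i; rewrite P0].
  by rewrite f0_lin; lra.
have [i0 Pi0] : exists i0, P i0.
  by have /card_gt0P[i0 ?] : (0 < #|P|)%N by [rewrite cardP]; exists i0.
pose P' := [pred i | P i & i != i0].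
have cardP' : #|P'| = n.
  move: cardP; rewrite (cardD1 i0) unfold_in Pi0 add1n => -[<-].
  by apply: eq_card => i; rewrite !inE andbC.
have [imp'|] := pselect (forall d, M d ->
    (forall i, P' i -> f i d <= 0) -> f0 d <= 0).
  have [lam lam_ge0 lamE] := IHn P' M cardP' M_lin imp'.
  exists (fun i => if i == i0 then 0 else lam i) => [i|d Md].
    by case: ifP.
  rewrite lamE// [RHS](bigD1 i0)//= eqxx mul0r add0r.
  by apply: eq_bigr => i /andP[_ /negPf->].
move=> /existsNP[x /not_implyP[Mx /not_implyP[fx /negP]]].
rewrite -ltNge => f0x.
have fi0x : 0 < f i0 x.
  rewrite ltNge; apply/negP => fi0x.
  suff : f0 x <= 0 by rewrite leNgt f0x.
  apply: imp => // i Pi; have [->//|ii0] := eqVneq i i0.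
  by apply: fx; rewrite /= Pi.
(* [d - c d *: x] is the projection of [d] on the kernel of [f i0] *)
pose c d := f i0 d / f i0 x.
pose M' := [set d | M d /\ f i0 d = 0].
have M'_lin a y z : M' y -> M' z -> M' (a *: y + z).
  move=> [My y0] [Mz z0]; split; first exact: M_lin.
  by rewrite f_lin y0 z0 mulr0 addr0.
have [lam lam_ge0 lamE] : exists2 lam : I -> R, forall i, 0 <= lam i &
    forall d, M' d -> f0 d = \sum_(i | P' i) lam i * f i d.
  apply: IHn => // d [Md d0] fd; apply: imp => // i Pi.
  by have [->|ii0] := eqVneq i i0; [rewrite d0|apply: fd; rewrite /= Pi].
pose l0 := (f0 x - \sum_(i | P' i) lam i * f i x) / f i0 x.
exists (fun i => if i == i0 then l0 else lam i) => [i|d Md].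
  case: ifP => // _; rewrite divr_ge0 ?(ltW fi0x)// subr_ge0.
  apply: le_trans (ltW f0x); apply: sumr_le0 => k Pk.
  by rewrite mulr_ge0_le0// fx.
rewrite [RHS](bigD1 i0)//= eqxx.
rewrite (eq_bigr (fun i => lam i * f i d)); last first.
  by move=> i /andP[_ /negPf->].
have : f0 ((- c d) *: x + d) = \sum_(i | P' i) lam i * f i ((- c d) *: x + d).
  apply: lamE; split; first exact: M_lin.
  by rewrite f_lin /c mulNr divfK ?gt_eqF// addNr.
rewrite f0_lin.
under [X in _ = X -> _]eq_bigr do rewrite f_lin mulrDr mulrCA.
rewrite big_split/= -mulr_sumr => f0E.
have -> : l0 * f i0 d = c d * (f0 x - \sum_(i | P' i) lam i * f i x).
  by rewrite /l0 /c mulrAC [RHS]mulrAC [f i0 d * _]mulrC.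
lra.
Qed.

(** A consequence of [farkas] on [V * R]: the alternative says that the
    constraints [a i d + s <= 0] and [b k d <= 0] imply [s <= 0]. In the
    resulting expression of [s], the coefficient of [s] gives the normalisation
    of [mu], and setting [s] to 0 gives the identity on [M]. *)
Lemma motzkin (V : lmodType R) (I K : finType) (P : pred I) (Q : pred K)
    (M : set V) (a : I -> V -> R) (b : K -> V -> R) :
  M 0 -> (forall c x y, M x -> M y -> M (c *: x + y)) ->
  (forall i, scalar (a i)) -> (forall k, scalar (b k)) ->
  (forall d, M d -> (forall k, Q k -> b k d <= 0) ->
     exists2 i, P i & 0 <= a i d) ->
  exists mu : I -> R, exists lam : K -> R,
    [/\ forall i, 0 <= mu i, forall k, 0 <= lam k, \sum_(i | P i) mu i = 1 &
        forall d, M d ->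
          \sum_(i | P i) mu i * a i d + \sum_(k | Q k) lam k * b k d = 0].
Proof.
move=> M0 M_lin a_lin b_lin alt.
pose f (ik : I + K) (z : V * R^o) : R :=
  match ik with inl i => a i z.1 + z.2 | inr k => b k z.1 end.
pose PQ (ik : I + K) := match ik with inl i => P i | inr k => Q k end.
have [| | | |lam lam_ge0 lamE] := @farkas (V * R^o)%type (I + K)%type PQ
    [set z | M z.1] f snd.
- by move=> c x y /= Mx My; exact: M_lin.
- case=> [i|k] c x y /=; last exact: b_lin.
  by rewrite a_lin mulrDr addrACA.
- by [].
- move=> z /= Mz fz; have [k Qk|i Pi ai] := alt _ Mz.
    exact: (fz (inr k)).
  by have := fz (inl i) Pi; rewrite /=; lra.
have sumE d s : M d -> s = \sum_(i | P i) lam (inl i) * (a i d + s) +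
    \sum_(k | Q k) lam (inr k) * b k d.
  by move=> Md; rewrite [LHS](lamE (d, s))// big_sumType.
have a0 i : a i 0 = 0 by have := a_lin i (-1) 0 0; rewrite scaler0 addr0; lra.
have b0 k : b k 0 = 0 by have := b_lin k (-1) 0 0; rewrite scaler0 addr0; lra.
exists (lam \o inl), (lam \o inr).
split => [i|k||d Md]; rewrite /=; [by []|by []| |].
  rewrite [RHS](sumE 0 1)// [X in _ = _ + X]big1 => [|k _].
    by rewrite addr0; apply: eq_bigr => i _; rewrite a0 add0r mulr1.
  by rewrite b0 mulr0.
by rewrite [RHS](sumE d 0)//; under [in RHS]eq_bigr do rewrite addr0.
Qed.

End Alternatives.

(** * Convex sets *)

Section Convexity.
Context {R : realType} {V : lmodType R}.

Lemma convex_setP (D : set V) :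
  convex_set D <-> forall x y (s t : R), 0 <= s -> 0 <= t -> s + t = 1 ->
    D x -> D y -> D (s *: x + t *: y).
Proof.
split=> [cD x y s t s0 t0 st Dx Dy|cD x y t /set_mem Dx /set_mem Dy].
  have s1 : s <= 1 by lra.
  have := cD x y (Itv01 s0 s1) (mem_set Dx) (mem_set Dy).
  rewrite inE; have <- : 1 - s = t by lra.
  exact.
by apply/mem_set/cD => //; rewrite /= ?subr_ge0 ?le1// addrC subrK.
Qed.

Lemma convex_set_combination (D : set V) (I : finType) (P : pred I)
    (mu : I -> R) (w : I -> V) :
  convex_set D -> (forall i, 0 <= mu i) -> \sum_(i | P i) mu i = 1 ->
  (forall i, P i -> D (w i)) -> D (\sum_(i | P i) mu i *: w i).
Proof.
move=> /convex_setP cD mu_ge0 mu1 Dw.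
(* partial sums of weights may vanish, so that normalised partial combinations
   need not exist: the invariant asks for a point of [D] only when [0 < s] *)
pose K (s : R) (z : V) :=
  0 <= s /\ exists2 x, (0 < s -> D x) & z = s *: x.
have : K (\sum_(i | P i) mu i) (\sum_(i | P i) mu i *: w i).
  apply: (big_ind2 K).
  - by split=> //; exists 0; rewrite ?ltxx ?scaler0.
  - move=> s _ t _ [s0 [x Dx ->]] [t0 [y Dy ->]]; split; first exact: addr_ge0.
    have [->|s_neq0] := eqVneq s 0.
      by exists y; rewrite ?scale0r !add0r//; exact: Dy.
    have [->|t_neq0] := eqVneq t 0.
      by exists x; rewrite ?scale0r !addr0//; exact: Dx.
    have {}s0 : 0 < s by rewrite lt_def s_neq0.
    have {}t0 : 0 < t by rewrite lt_def t_neq0.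
    exists ((s / (s + t)) *: x + (t / (s + t)) *: y).
      move=> st0; apply: cD; rewrite ?divr_ge0 ?ltW//; last first.
      + exact: Dy.
      + exact: Dx.
      by rewrite -mulrDl divff// gt_eqF.
    by rewrite scalerDr !scalerA !(mulrC (s + t)) !divfK// gt_eqF ?addr_gt0.
  - by move=> i Pi; split=> //; exists (w i) => // _; exact: Dw.
by rewrite mu1 => -[_ [x Dx ->]]; rewrite scale1r; exact: Dx.
Qed.

Lemma convex_conv_hull (A : set V) : convex_set (conv_hull A).
Proof.
by move=> x y t /set_mem Ax /set_mem Ay; apply/mem_set => D [cD AD];
  apply/set_mem/cD; apply/mem_set; [exact: Ax|exact: Ay].
Qed.

Lemma sub_conv_hull (A : set V) : A `<=` conv_hull A.
Proof. exact: sub_gen_smallest. Qed.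

Lemma conv_hull_sub (A D : set V) :
  convex_set D -> A `<=` D -> conv_hull A `<=` D.
Proof. exact: smallest_sub. Qed.

Lemma convex_set_sum (A B : set V) :
  convex_set A -> convex_set B -> convex_set (set_sum A B).
Proof.
move=> /convex_setP cA /convex_setP cB; apply/convex_setP.
move=> _ _ s t s0 t0 st [a Aa [b Bb <-]] [a' Aa' [b' Bb' <-]].
exists (s *: a + t *: a'); first exact: cA.
exists (s *: b + t *: b'); first exact: cB.
by rewrite !scalerDr addrACA.
Qed.

Lemma convex_pos_hull (I : finType) (K : set I) (w : I -> V) :
  convex_set (pos_hull K w).
Proof.
apply/convex_setP => _ _ s t s0 t0 _ [l l0 ->] [l' l'0 ->].
exists (fun k => s * l k + t * l' k) => [k Kk|].
  by rewrite addr_ge0// mulr_ge0// ?l0 ?l'0.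
rewrite !scaler_sumr -big_split/=; apply: eq_bigr => k _.
by rewrite !scalerA -scalerDl.
Qed.

End Convexity.

(** * Continuous functionals and maxima of finitely many affine functions *)

Section Local.
Context {R : realType} {X : tvsType R}.

Lemma topdual_linearE (a : R) (f : topdual X) (x y : X) :
  f (a *: x + y) = a * f x + f y.
Proof. exact: topdual_linear. Qed.

Lemma topdual0 (f : topdual X) : f 0 = 0.
Proof. by have := topdual_linearE (-1) f 0 0; rewrite scaler0 addr0; lra. Qed.

Lemma topdualBr (f : topdual X) (x y : X) : f (x - y) = f x - f y.
Proof. by rewrite addrC -scaleN1r topdual_linearE mulN1r addrC. Qed.

Lemma topdual_sum (I : finType) (P : pred I) (c : I -> R)
    (f : I -> topdual X) (x : X) :
  (\sum_(i | P i) c i *: f i) x = \sum_(i | P i) c i * f i x.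
Proof. by apply: (big_morph (fun k : topdual X => k x)). Qed.

Lemma convex_annihilator (M : set X) : convex_set (annihilator M).
Proof.
apply/convex_setP => f k s t _ _ _ fM kM x Mx.
by rewrite topdualD !topdualZ fM// kM// !mulr0 addr0.
Qed.

Lemma max_affine_attained (m : nat) (u : 'I_m -> topdual X)
    (alpha : 'I_m -> R) (x : X) : (-oo < max_affine u alpha x)%E ->
  exists i, max_affine u alpha x = (u i x + alpha i)%:E.
Proof.
rewrite /max_affine; case: m u alpha => [|m] u alpha.
  by rewrite big_ord0.
move=> _; rewrite (bigmax_eq_arg _ ord0)//; first by eexists.
by move=> i _; rewrite leNye.
Qed.

(** An inactive piece is strictly below an active one at [xbar], and by
    continuity on a neighbourhood of [xbar] too, so that the maximum is attained
    by an active piece there. All active pieces share the value [r] at [xbar],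
    which leaves only their linear parts to be compared. *)
Lemma near_max_affine (m : nat) (u : 'I_m -> topdual X) (alpha : 'I_m -> R)
    (phi : X -> \bar R) (xbar : X) :
  proper_fun phi -> (forall x, edom phi x -> phi x = max_affine u alpha x) ->
  (edom phi)° xbar ->
  exists2 r : R, phi xbar = r%:E &
    \forall x \near xbar, exists i, [/\ active_pieces u alpha phi xbar i,
      phi x = (r + u i (x - xbar))%:E &
      forall k, active_pieces u alpha phi xbar k ->
        u k (x - xbar) <= u i (x - xbar)].
Proof.
move=> [_ phi_gt] phiE xbar_int.
have attained x : edom phi x -> exists i, phi x = (u i x + alpha i)%:E.
  by move=> dx; have := phi_gt x; rewrite phiE// => /max_affine_attained.
have le_phi x k : edom phi x -> ((u k x + alpha k)%:E <= phi x)%E.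
  move=> dx; rewrite phiE// /max_affine.
  exact: (le_bigmax _ (fun k => (u k x + alpha k)%:E)).
have [i0 i0E] := attained _ (nbhs_singleton xbar_int).
exists (u i0 xbar + alpha i0) => //.
have cvg_piece k : u k x + alpha k @[x --> xbar] --> u k xbar + alpha k.
  by apply: (@cvgD R R^o); [exact: topdual_continuous|exact: cvg_cst].
have inactive : \forall x \near xbar, forall k,
    ~ active_pieces u alpha phi xbar k ->
    u k x + alpha k < u i0 x + alpha i0.
  apply: filter_forall => k.
  have [?|kN] := pselect (active_pieces u alpha phi xbar k).
    by apply: nearW.
  have lt0 : 0 < u i0 xbar + alpha i0 - (u k xbar + alpha k).
    rewrite subr_gt0 lt_neqAle; apply/andP; split; last first.
      by rewrite -lee_fin -i0E le_phi//; exact: nbhs_singleton.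
    by apply/eqP => kE; apply: kN; rewrite /active_pieces/= kE i0E.
  have cvg_diff := @cvgB R R^o _ _ _ _ _ _ _
    (cvg_piece i0) (cvg_piece k).
  have near_lt : \forall x \near xbar,
      0 < u i0 x + alpha i0 - (u k x + alpha k).
    exact: (cvgr_gt _ (cvg_diff _) _ lt0).
  by near=> x => _; rewrite -subr_gt0; near: x.
near=> x.
have dx : edom phi x by near: x; exact: xbar_int.
have [i iE] := attained _ dx.
have i_act : active_pieces u alpha phi xbar i.
  apply: contrapT => iN.
  have lt_i : u i x + alpha i < u i0 x + alpha i0.
    by move: i iN {iE}; near: x.
  by have := le_phi x i0 dx; rewrite iE lee_fin leNgt lt_i.
have actE k : active_pieces u alpha phi xbar k ->
    u k xbar + alpha k = u i0 xbar + alpha i0.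
  by rewrite /active_pieces/= i0E => -[].
exists i; split=> //.
  by rewrite iE topdualBr; congr _%:E; have := actE i i_act; lra.
move=> k k_act; have := le_phi x k dx; rewrite iE lee_fin !topdualBr.
by have := actE i i_act; have := actE k k_act; lra.
Unshelve. all: by end_near. Qed.

Lemma nbhs_ray (x d : X) (P : set X) :
  nbhs x P -> exists2 t : R, 0 < t & P (x + t *: d).
Proof.
move=> nbhsP.
have scale_cvg : t *: d @[t --> (0 : R)] --> (0 : X).
  rewrite -[X in _ --> nbhs X](scale0r d).
  apply: (@continuous2_cvg R R^o X X _ _ (fun t => t) (cst d) *:%R 0 d) => //.
  - exact: (@scale_continuous R X (0, d)).
  - exact: cvg_cst.
have ray_cvg : x + t *: d @[t --> (0 : R)] --> x.
  rewrite -[X in _ --> nbhs X](addr0 x).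
  apply: (@continuous2_cvg R X X X _ _ (cst x) ( *:%R^~ d) +%R x 0) => //.
  - exact: (@add_continuous X (x, 0)).
  - exact: cvg_cst.
have near_P : \forall t \near (0 : R)^'+, 0 < t /\ P (x + t *: d).
  by near=> t; split => //; near: t; exact: cvg_within_filter ray_cvg _ nbhsP.
by have [t [t_gt0 Pt]] := filter_ex near_P; exists t.
Unshelve. all: by end_near. Qed.

End Local.

(** * Local solutions of the difference problem *)

Theorem theorem3p5 (R : realType) (X Y : tvsType R)
    (hX : hausdorff_space X) (hY : hausdorff_space Y)
    (g h : X -> \bar R)
    (m q : nat)
    (u : 'I_m -> topdual X) (alpha : 'I_m -> R)
    (v : 'I_q -> topdual X) (beta : 'I_q -> R)
    (g_proper : proper_fun g) (g_gpc : gen_polyhedral_convex_fun g)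
    (h_proper : proper_fun h) (h_gpc : gen_polyhedral_convex_fun h)
    (g_max : forall x, edom g x -> g x = max_affine u alpha x)
    (h_max : forall x, edom h x -> h x = max_affine v beta x)
    (A : {linear X -> Y}) (A_cont : continuous A)
    (A_surj : set_surj [set: X] [set: Y] A)
    (y : Y) (p : nat) (xs : 'I_p -> topdual X) (gamma : 'I_p -> R)
    (C_neq0 : constraint_set A y xs gamma !=set0)
    (xbar : X)
    (xbarP : ((edom g)° `&` (edom h)° `&` constraint_set A y xs gamma) xbar) :
  local_solution (constraint_set A y xs gamma) (dc_fun g h) xbar <->
  conv_hull (v @` active_pieces v beta h xbar) `<=`
    set_sum
      (set_sum (conv_hull (u @` active_pieces u alpha g xbar))
               (pos_hull (active_constraints xs gamma xbar) xs))
      (annihilator (ker A)).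
Proof.
case: xbarP => -[xbar_g xbar_h] [Axbar xbar_ineq].
have [rg gxbar near_g] := near_max_affine g_proper g_max xbar_g.
have [rh hxbar near_h] := near_max_affine h_proper h_max xbar_h.
set I := active_pieces u alpha g xbar in near_g *.
set J := active_pieces v beta h xbar in near_h *.
set K := active_constraints xs gamma xbar.
have dc_le x a b : g x = (rg + a)%:E -> h x = (rh + b)%:E ->
    (dc_fun g h xbar <= dc_fun g h x)%E = (b <= a).
  move=> gx hx; rewrite /dc_fun gxbar hxbar gx hx.
  rewrite -!DualAddTheoryNumDomain.dEFinB lee_fin.
  by apply/idP/idP; lra.
split=> [[_ [U nbhsU xbar_min]]|incl].
- apply: conv_hull_sub => [|_ [j Jj <-]].
    apply: (@convex_set_sum _ (topdual X)); last exact: convex_annihilator.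
    apply: (@convex_set_sum _ (topdual X)); last exact: convex_pos_hull.
    exact: convex_conv_hull.
  have [||i|k||mu [lam [mu_ge0 lam_ge0 mu1 mulam0]]] :=
    @motzkin R X _ _ (mem I) (mem K) (ker A) (fun i d => u i d - v j d)
      (fun k d => xs k d).
  + exact: linear0.
  + by rewrite /ker => c x z /= Ax Az; rewrite linearP Ax Az scaler0 addr0.
  + by move=> c x z; rewrite !topdual_linearE; lra.
  + by move=> c x z; exact: topdual_linearE.
  + move=> d Ad dK.
    (* inactive constraints stay satisfied for a short step along [d] *)
    have near_slack : \forall x \near xbar,
        forall k, ~ K k -> xs k x < gamma k.
      apply: filter_forall => k.
      have [?|Kk] := pselect (K k); first by apply: nearW.
      have lt_k : xs k xbar < gamma k.
        by rewrite lt_neqAle xbar_ineq andbT; apply/eqP.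
      have near_lt : \forall x \near xbar, xs k x < gamma k.
        exact: (cvgr_lt _ (@topdual_continuous _ _ (xs k) xbar) _ lt_k).
      by near=> x => _; near: x.
    have [t t_gt0 [Ut [slack [[i [Ii gt _]] [j' [_ ht /(_ j Jj)]]]]]] :=
      @nbhs_ray _ _ xbar d _
        (filterI nbhsU (filterI near_slack (filterI near_g near_h))).
    have Ct : constraint_set A y xs gamma (xbar + t *: d).
      split=> [|k]; first by rewrite linearD linearZ/= Ad scaler0 addr0.
      have [Kk|/slack/ltW//] := pselect (K k).
      rewrite addrC topdual_linearE Kk gerDr pmulr_rle0//.
      by apply: dK; rewrite inE.
    have := xbar_min _ (conj Ct Ut); rewrite (dc_le _ _ _ gt ht).
    rewrite [xbar + _]addrC addrK -(addr0 (t *: d)).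
    rewrite !topdual_linearE !topdual0 !addr0.
    move=> le1 le2; exists i; first by rewrite inE.
    by rewrite subr_ge0 -(ler_pM2l t_gt0) (le_trans le2).
  pose us := \sum_(i | i \in I) mu i *: u i.
  pose xks := \sum_(k | k \in K) lam k *: xs k.
  exists (us + xks).
    exists us.
      apply: convex_set_combination => // [|i Ii].
        exact: convex_conv_hull.
      by apply: sub_conv_hull; exists i => //; exact/set_mem.
    by exists xks => //; exists lam.
  exists (v j - (us + xks)); last by rewrite addrC subrK.
  move=> d Ad; rewrite addrC -scaleN1r topdualD topdualZ topdualD.
  rewrite !topdual_sum mulN1r.
  have := mulam0 d Ad.
  under eq_bigr do rewrite mulrBr.
  rewrite sumrB -mulr_suml mu1 mul1r; lra.
- split=> //; eexists; first exact: (filterI near_g near_h).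
  move=> x [[Ax x_ineq] [[i [Ii gx ui_max]] [j [Jj hx _]]]].
  rewrite (dc_le _ _ _ gx hx).
  have [_ [co_u co_uP [_ [lam lam_ge0 ->] <-]] [a aP <-]] :=
    incl (v j) (sub_conv_hull (imageP v Jj)).
  rewrite !topdualD [a _]aP ?addr0; last first.
    by rewrite /ker/= linearB/= Ax Axbar subrr.
  rewrite topdual_sum -[leRHS]addr0; apply: lerD.
    have : conv_hull (u @` I) `<=`
        [set w : topdual X | w (x - xbar) <= u i (x - xbar)].
      apply: conv_hull_sub => [|_ [k Ik <-]]; last exact: ui_max.
      apply/convex_setP => w z s t s0 t0 st wx zx; rewrite /mkset.
      rewrite topdualD !topdualZ.
      by rewrite -[leRHS]mul1r -st mulrDl lerD ?ler_wpM2l.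
    exact.
  apply: sumr_le0 => k /set_mem Kk; rewrite mulr_ge0_le0 ?lam_ge0//.
  by rewrite topdualBr subr_le0 Kk.
Unshelve. all: by end_near. Qed.
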